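(* If $x^{v_1},\ldots,x^{v_q}$ all have the same degree $d\ge 2$, then $I^i=I^{(i)}$ for all $i\ge 1$ if and only if $Q(A)$ is integral and $K[Ft]=A(P)$.
   Context: Let $R=K[x_1,\ldots,x_n]$ be a polynomial ring over a field $K$, write $x^a=x_1^{a_1}\cdots x_n^{a_n}$, and let $I\subset R$ be an ideal of height $g\ge 2$ minimally generated by a finite set $F=\{x^{v_1},\ldots,x^{v_q}\}$ of square-free monomials of degree at least two. Each variable $x_i$ divides at least one monomial of $F$. Let $A$ be the $n\times q$ matrix with column vectors $v_1,\ldots,v_q$. The set covering polyhedron is $Q(A)=\{x\in\mathbb R^n\mid x\ge 0,\ xA\ge\mathbf 1\}$, $\mathbf 1=(1,\ldots,1)$; it is called integral if all its vertices have integral entries. If $\mathfrak p_1,\ldots,\mathfrak p_s$ are the minimal primes of $I$, the $i$th symbolic power of $I$ is $I^{(i)}=\mathfrak p_1^i\cap\cdots\cap\mathfrak p_s^i$. Let $P=\mathrm{conv}(v_1,\ldots,v_q)\subset\mathbb R^n$. The Ehrhart ring of $P$ is $A(P)=K[\{x^at^i\mid a\in\mathbb Z^n\cap iP,\ i\in\mathbb N\}]\subset R[t]$ ($t$ a new variable), and $K[Ft]=K[x^{v_1}t,\ldots,x^{v_q}t]\subset R[t]$. *)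

(* Defs.v *)
Set Warnings "-notation-overridden,-ambiguous-paths,-notation-incompatible-prefix".
From HB Require Import structures.
From mathcomp Require Import all_boot all_order all_algebra.
From mathcomp Require Import mpoly classical_sets reals.

Set Implicit Arguments.
Unset Strict Implicit.
Unset Printing Implicit Defensive.
Import Order.TTheory GRing.Theory Num.Theory.

Local Open Scope classical_set_scope.
Local Open Scope ring_scope.

Section Ideals.
Variable S : comNzRingType.
Implicit Types (I J p : set S) (G : set S).

(* Ideals are Prop-valued sets and may be improper; idealr_closed from
   ring_quotient only covers decidable proper ideals. *)
Definition is_ideal I : Prop :=
  [/\ I 0,
      forall a b, I a -> I b -> I (a + b)
    & forall r a, I a -> I (r * a)].

Definition ideal_gen G : set S := smallest is_ideal G.

Definition minimally_generates G I : Prop :=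
  ideal_gen G = I /\ forall G', G' `<` G -> ideal_gen G' <> I.

Definition ideal_mul I J : set S :=
  ideal_gen [set x | exists a b, [/\ I a, J b & x = a * b]].

Fixpoint ideal_pow I (i : nat) : set S :=
  if i is i'.+1 then ideal_mul I (ideal_pow I i') else setT.

Definition is_prime p : Prop :=
  [/\ is_ideal p, ~ p 1 & forall a b, p (a * b) -> p a \/ p b].

Definition minimal_prime I p : Prop :=
  [/\ is_prime p, I `<=` p
    & forall p', is_prime p' -> I `<=` p' -> p' `<=` p -> p' = p].

Definition symbolic_pow I (i : nat) : set S :=
  \bigcap_(p in minimal_prime I) ideal_pow p i.

(* c 0 `<` c 1 `<` ... `<` c h = p *)
Definition prime_chain p (h : nat) : Prop :=
  exists c : nat -> set S,
    [/\ forall k, (k <= h)%N -> is_prime (c k),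
        forall k, (k < h)%N -> c k `<` c k.+1
      & c h = p].

(* Chains can be truncated from below, so prime_chain p g says that the
   height of p is at least g, and ~ prime_chain p g.+1 that it is at most g;
   the height of I is the minimum over the primes containing I. *)
Definition ideal_height I (g : nat) : Prop :=
  (forall p, is_prime p -> I `<=` p -> prime_chain p g) /\
  (exists p, [/\ is_prime p, I `<=` p & ~ prime_chain p g.+1]).

End Ideals.

Section Polyhedra.
Variables (R : realType) (n q : nat).

Definition set_covering_polyhedron (A : 'M[R]_(n, q)) : set 'rV[R]_n :=
  [set x : 'rV[R]_n | (forall i, 0 <= x 0 i) /\ (forall j, 1 <= (x *m A) 0 j)].

Definition vertex (Q : set 'rV[R]_n) (x : 'rV[R]_n) : Prop :=
  Q x /\ forall y z (s : R), Q y -> Q z -> 0 < s < 1 ->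
    x = s *: y + (1 - s) *: z -> y = x /\ z = x.

Definition integral_polyhedron (Q : set 'rV[R]_n) : Prop :=
  forall x, vertex Q x -> forall i, x 0 i \is a Num.int.

Definition conv_hull (w : 'I_q -> 'rV[R]_n) : set 'rV[R]_n :=
  [set x : 'rV[R]_n | exists l : 'I_q -> R,
     [/\ forall j, 0 <= l j, \sum_j l j = 1 & x = \sum_j l j *: w j]].

Definition exp_vec (a : 'X_{1..n}) : 'rV[R]_n := \row_i (a i)%:R.

Definition exp_matrix (v : 'I_q -> 'X_{1..n}) : 'M[R]_(n, q) :=
  \matrix_(i, j) (v j i)%:R.

End Polyhedra.

Section Algebras.
Variables (K : fieldType) (n : nat).

(* t is the variable 'X of {poly {mpoly K[n]}}; closure under opposites comes
   from the scalar -1. *)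
Definition is_subalgebra (B : set {poly {mpoly K[n]}}) : Prop :=
  [/\ forall c : K, B (c%:MP)%:P,
      forall f h, B f -> B h -> B (f + h)
    & forall f h, B f -> B h -> B (f * h)].

Definition subalgebra_gen (G : set {poly {mpoly K[n]}}) :
  set {poly {mpoly K[n]}} := smallest is_subalgebra G.

Definition monom_t (a : 'X_{1..n}) (i : nat) : {poly {mpoly K[n]}} :=
  ('X_[K, a])%:P * 'X^i.

(* K[Ft] *)
Definition monomial_subring (q : nat) (v : 'I_q -> 'X_{1..n}) :
  set {poly {mpoly K[n]}} := subalgebra_gen (range (fun j => monom_t (v j) 1)).

(* The lattice points a range over N^n rather than Z^n, which changes nothing
   when P lies in the nonnegative orthant, as does the convex hull of
   exponent vectors. *)
Definition ehrhart_ring (R : realType) (P : set 'rV[R]_n) :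
  set {poly {mpoly K[n]}} :=
  subalgebra_gen [set f | exists (a : 'X_{1..n}) (i : nat),
    [set i%:R *: y | y in P] (exp_vec R a) /\ f = monom_t a i].

End Algebras.

Arguments monomial_subring K {n q} v _.
Arguments ehrhart_ring K {n R} P _.

(* Main.v *)
Require Import Defs.
Set Warnings "-notation-overridden,-ambiguous-paths,-notation-incompatible-prefix".
From HB Require Import structures.
From mathcomp Require Import all_boot all_order all_algebra.
From mathcomp Require Import mpoly classical_sets reals.
From mathcomp Require Import boolp lra.

Set Implicit Arguments.
Unset Strict Implicit.
Unset Printing Implicit Defensive.
Import Order.TTheory GRing.Theory Num.Theory.

Local Open Scope classical_set_scope.
Local Open Scope ring_scope.

(** Everything reduces to a statement about exponent vectors. Call a set [C]
of variables a cover when it meets every [v j], and write [cdeg C a] for the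
total exponent in [x^a] of the variables of [C].

The minimal primes of [I] are generated by the minimal covers, so [I^(i)] is
spanned by the [x^a] with [i <= cdeg C a] for every cover [C]
([symbolic_powP]), whereas [I^i] is spanned by the [x^a] divisible by a product
of [i] generators; such an [a] is said to pack [i] ([ideal_powP]). Hence
[I^i = I^(i)] for all [i >= 1] is a min-max property: every [a] packs the
minimum of [cdeg C a] over the covers [C]. Likewise [K[Ft] = A(P)] says that
every lattice point of [iP] is a sum of [i] of the [v j]
([monomial_subring_ehrhart]).

If the min-max property holds, let [x] be a vertex of [Q(A)] and let [a] be the
sum of the integral normals of the constraints tight at [x]. On [Q(A)] the
functional [a] attains its minimum, the number [m] of tight constraints of the
form [v j . x = 1], only at [x]. If [x] is not the indicator of a cover, then
[cdeg C a > m] for each cover [C], so [a] packs [m + 1] and its value at [x] is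
at least [m + 1], a contradiction ([min_max_integral]). A lattice point [a] of
[iP] has [cdeg C a >= i] for each cover, so it packs [i], and because all
generators have the same degree [d], comparing [i d] with the degree of [a]
shows that nothing is left over ([min_max_hull_decomposes]).

Conversely let [cdeg C a >= i] for every cover, with [a] minimal for this
property. On each point of [Q(A)] the functional [a] is at least as large as on
some vertex ([vertex_below]); vertices are integral and so dominate indicators
of covers, whence [a] is at least [i] on [Q(A)], and linear
programming duality yields real [y >= 0] with total [i] and
[\sum_j y j v j <= a]. By minimality each [k] with [a k > 0] lies in a cover
[C] with [cdeg C a = i]; summing over [C] forces equality in all coordinates of
[C]. So [a] is a lattice point of [iP], and [K[Ft] = A(P)] makes it a sum of [i]
of the [v j] ([integral_hull_decomposes_min_max]). *)

(** * Linear inequalities *)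

(** Induction on the number of columns of [W]. If the last [m] columns do not
suffice, some [x0] separates [c] from them; then [x0] is negative on the first
column [w], and the projection along [x0] onto the hyperplane [x *m w = 0]
reduces the problem to the remaining columns. *)
Lemma farkas (R : realFieldType) (n m : nat) (W : 'M[R]_(n, m)) (c : 'cV[R]_n) :
  (forall x : 'rV[R]_n, (forall j, 0 <= (x *m W) 0 j) -> 0 <= (x *m c) 0 0) ->
  exists2 l : 'cV[R]_m, forall j, 0 <= l j 0 & c = W *m l.
Proof.
elim: m W c => [|m IH] W c Hc.
  exists 0 => [[]//|]; rewrite mulmx0.
  apply/colP => k; rewrite mxE.
  have := Hc (- delta_mx 0 k) (fun j => False_ind _ (notF (ltn_ord j))).
  have := Hc (delta_mx 0 k) (fun j => False_ind _ (notF (ltn_ord j))).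
  by rewrite mulNmx -rowE !mxE; lra.
move: W Hc; rewrite -[m.+1]/(1 + m)%N => W Hc.
set w := lsubmx W; set W' := rsubmx W.
have defW : W = row_mx w W' by rewrite hsubmxK.
have [H|] := pselect (forall x : 'rV[R]_n,
    (forall j, 0 <= (x *m W') 0 j) -> 0 <= (x *m c) 0 0).
  have [l l0 ->] := IH _ _ H.
  exists (col_mx (0 : 'M_1) l); last by rewrite defW mul_row_col mulmx0 add0r.
  by move=> j; rewrite -(splitK j); case: (split j) => k /=;
    rewrite ?col_mxEu ?col_mxEd ?mxE.
move=> /existsNP[x0 /not_implyP[x0W /negP]]; rewrite -ltNge => x0c.
set s := (x0 *m w) 0 0.
have s_lt0 : s < 0.
  rewrite ltNge; apply/negP => s0.
  suff : 0 <= (x0 *m c) 0 0 by rewrite leNgt x0c.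
  apply: Hc => j; rewrite defW mul_mx_row -(splitK j).
  by case: (split _) => k /=; rewrite ?row_mxEl ?row_mxEr ?(ord1 k).
(* [x *m P] is the projection of [x] along [x0] onto [x *m w = 0]. *)
pose P : 'M_n := 1%:M - s^-1 *: (w *m x0).
have PE p (M : 'M_(n, p)) : P *m M = M - s^-1 *: (w *m (x0 *m M)).
  by rewrite mulmxBl mul1mx -scalemxAl mulmxA.
have Pw : P *m w = 0.
  rewrite PE [x0 *m w]mx11_scalar -/s mul_mx_scalar scalerA.
  by rewrite mulVf ?scale1r ?subrr // lt_eqF.
have [x xPW|l l0] := IH (P *m W') (P *m c).
  rewrite mulmxA; apply: Hc => j; rewrite defW mul_mx_row -(splitK j).
  case: (split _) => k /=; last by rewrite row_mxEr -mulmxA.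
  by rewrite row_mxEl -mulmxA Pw mulmx0 mxE.
rewrite -mulmxA !PE => /(canRL (subrK _)) ->.
have x0W'l : 0 <= (x0 *m (W' *m l)) 0 0.
  by rewrite mulmxA mxE; apply: sumr_ge0 => j _; rewrite mulr_ge0.
set b := (x0 *m (W' *m l)) 0 0 in x0W'l.
exists (col_mx (s^-1 * ((x0 *m c) 0 0 - b))%:M l).
  move=> j; rewrite -(splitK j); case: (split j) => k /=;
    rewrite ?col_mxEu ?col_mxEd // (ord1 k) mxE eqxx mulr1n.
  by rewrite mulr_le0 ?invr_le0 ?ltW// subr_lt0 (lt_le_trans x0c).
rewrite {1}defW mul_row_col mul_mx_scalar.
rewrite [x0 *m (W' *m l)]mx11_scalar -/b.
set a := (x0 *m c) 0 0; rewrite [x0 *m c]mx11_scalar -/a !mul_mx_scalar !scalerA.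
by rewrite mulrBr scalerBl [RHS]addrC addrA [LHS]addrAC.
Qed.

(** * Vertices of the covering polyhedron *)

Section Polyhedron.
Variables (R : realType) (n q : nat) (A : 'M[R]_(n, q)).
Implicit Types (x u z : 'rV[R]_n) (c : 'cV[R]_n).

(** Strong duality for the covering program. The identity block in the matrix
given to [farkas] carries the slack variables of [A *m y <= c], and its last
row the condition on the total of [y]. *)
Lemma covering_duality c (t : R) :
  0 <= t -> (forall k, 0 <= c k 0) ->
  (forall x, set_covering_polyhedron A x -> t <= (x *m c) 0 0) ->
  exists y : 'cV[R]_q, [/\ forall j, 0 <= y j 0, \sum_j y j 0 = t
    & forall k, (A *m y) k 0 <= c k 0].
Proof.
move=> t0 c0 Hc.
have [x|l l0] := farkas (W := block_mx A 1%:M (const_mx 1 : 'M_(1, q)) 0)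
  (c := col_mx c (t%:M : 'M_1)).
  rewrite -(hsubmxK x); move: (lsubmx x) (rsubmx x) => u s.
  rewrite mul_row_block mul_row_col mulmx0 addr0 mulmx1 => H.
  have u0 k : 0 <= u 0 k by have := H (rshift q k); rewrite row_mxEr.
  have uA j : 0 <= (u *m A) 0 j + s 0 0.
    have := H (lshift n j); rewrite row_mxEl mxE.
    by rewrite [(s *m _) 0 j]mxE big_ord1 [const_mx _ _ _]mxE mulr1.
  have uc : 0 <= (u *m c) 0 0.
    by rewrite mxE; apply: sumr_ge0 => k _; rewrite mulr_ge0.
  rewrite mxE [(s *m _) 0 0]mxE big_ord1 [t%:M _ _]mxE eqxx mulr1n.
  have [s0|s0] := leP 0 (s 0 0); first by rewrite addr_ge0 // mulr_ge0.
  have /Hc : set_covering_polyhedron A ((- s 0 0)^-1 *: u).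
    split=> [k|j]; first by rewrite mxE mulr_ge0 // invr_ge0 oppr_ge0 ltW.
    rewrite -scalemxAl mxE mulrC ler_pdivlMr ?oppr_gt0 // mul1r.
    by have := uA j; lra.
  rewrite -scalemxAl mxE mulrC ler_pdivlMr ?oppr_gt0 //; lra.
rewrite -(vsubmxK l) mul_block_col => /eq_col_mx[ca tE].
exists (usubmx l); split=> [j||k]; first by rewrite mxE.
  move: tE => /matrixP/(_ 0 0); rewrite mul0mx addr0 mxE eqxx mulr1n mxE => ->.
  by apply: eq_bigr => j _; rewrite [const_mx _ _ _]mxE mul1r.
by rewrite ca mul1mx [leRHS]mxE lerDl mxE.
Qed.

(** Constraints are indexed by a sum type, so that nonnegativity and covering
constraints are treated alike; [slope] is the linear part of the affine map
[slack]. *)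
Definition slope x (e : 'I_n + 'I_q) : R :=
  match e with inl k => x 0 k | inr j => (x *m A) 0 j end.

Definition slack x (e : 'I_n + 'I_q) : R :=
  match e with inl k => x 0 k | inr j => (x *m A) 0 j - 1 end.

Lemma polyhedronP x :
  set_covering_polyhedron A x <-> forall e, 0 <= slack x e.
Proof.
split=> [[x0 xA] [k|j] /=|H]; [exact: x0|by rewrite subr_ge0|].
by split=> [k|j]; [exact: (H (inl k))|have := H (inr j); rewrite /= subr_ge0].
Qed.

Lemma slackD x u (t : R) e : slack (x + t *: u) e = slack x e + t * slope u e.
Proof. by case: e => i /=; rewrite ?mulmxDl -?scalemxAl !mxE // addrAC. Qed.

Lemma slopeB x z e : slope (x - z) e = slack x e - slack z e.
Proof. by case: e => i /=; rewrite ?mulmxBl !mxE // opprD addrACA subrr addr0. Qed.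

Definition tight x := [set e | slack x e == 0]%SET.

(** If [z] is tight wherever [x] is, the segment from [z] to [x] can be
prolonged a little beyond [x] inside the polyhedron. *)
Lemma vertex_tight_unique x z :
  vertex (set_covering_polyhedron A) x -> set_covering_polyhedron A z ->
  tight x \subset tight z -> z = x.
Proof.
move=> [/polyhedronP Qx Vx] Qz xz; have Qz' := (polyhedronP z).1 Qz.
(* Small enough that [e * slack z i <= slack x i] for each [i] not tight at [x];
   the indices tight at [x] add nothing to the sum, since [0^-1 = 0]. *)
pose e := (1 + \sum_i slack z i / slack x i)^-1.
have S0 i : 0 <= slack z i / slack x i by rewrite divr_ge0.
have e0 : 0 < e by rewrite invr_gt0 ltr_pwDl // sumr_ge0.
have Qy : set_covering_polyhedron A (x + e *: (x - z)).
  apply/polyhedronP => i; rewrite slackD slopeB.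
  have [xi0|xi0] := eqVneq (slack x i) 0.
    have := fintype.subsetP xz i; rewrite !inE xi0 eqxx => /(_ isT)/eqP ->.
    by rewrite subrr mulr0 addr0.
  have xi : 0 < slack x i by rewrite lt_def xi0 Qx.
  suff : e * slack z i <= slack x i.
    by have := mulr_ge0 (ltW e0) (Qx i); rewrite mulrBr; lra.
  rewrite mulrC ler_pdivrMr ?ltr_pwDl ?sumr_ge0 //.
  rewrite mulrC -ler_pdivrMr // (bigD1 i) //=.
  have : 0 <= \sum_(j | j != i) slack z j / slack x j by exact: sumr_ge0.
  lra.
have e1 : 1 + e != 0 by rewrite gt_eqF // addr_gt0.
apply: (Vx _ _ (1 + e)^-1 Qy Qz _ _).2.
  by rewrite invr_gt0 addr_gt0 //= invf_lt1 ?ltrDl ?addr_gt0.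
apply: (scalerI e1); rewrite scalerDr !scalerA mulrBr divff // mulr1 scale1r.
rewrite (addrAC 1) subrr add0r scalerBr -addrA subrK.
by rewrite scalerDl scale1r.
Qed.

(** A point that is not a vertex moves along a line on which its tight
constraints stay tight. As [c] and the polyhedron are nonnegative, the line
can be oriented so that the cost does not increase while some coordinate
decreases; hence another constraint is hit. *)
Lemma tighten_nonvertex c x :
  (forall k, 0 <= c k 0) -> set_covering_polyhedron A x ->
  ~ vertex (set_covering_polyhedron A) x ->
  exists x', [/\ set_covering_polyhedron A x', (x' *m c) 0 0 <= (x *m c) 0 0
    & tight x \proper tight x'].
Proof.
move=> c0 Qx /not_andP[//|/existsNP[y /existsNP[z /existsNP[s]]]].
move=> /not_implyP[Qy /not_implyP[Qz /not_implyP[/andP[s0 s1]]]].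
move=> /not_implyP[xE nyz].
have [u [u0 ut]] : exists u, u != 0 /\ forall e, slack x e = 0 -> slope u e = 0.
  exists (y - z); split.
    apply/eqP => /subr0_eq yz; apply: nyz.
    by move: xE; rewrite yz -scalerDl addrC subrK scale1r.
  move=> e; rewrite slopeB xE.
  rewrite (_ : s *: y + (1 - s) *: z = z + s *: (y - z)); last first.
    by rewrite scalerBl scale1r scalerBr addrCA.
  rewrite slackD slopeB => h.
  have ye := (polyhedronP y).1 Qy e; have ze := (polyhedronP z).1 Qz e.
  have ys := mulr_ge0 (ltW s0) ye.
  have zs : 0 <= (1 - s) * slack z e by rewrite mulr_ge0 // subr_ge0 ltW.
  have /eqP : s * slack y e = 0 by lra.
  have /eqP : (1 - s) * slack z e = 0 by lra.
  rewrite !mulf_eq0 subr_eq0 (gt_eqF s1) (gt_eqF s0) /= => /eqP -> /eqP ->.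
  by rewrite subrr.
have {u u0 ut} [u [uc [k uk] ut]] : exists u, [/\ (u *m c) 0 0 <= 0,
    exists k, u 0 k < 0 & forall e, slack x e = 0 -> slope u e = 0].
  have uNt e : slack x e = 0 -> slope (- u) e = 0.
    move=> /ut; case: e => i /= ue; rewrite ?mulNmx mxE ue; exact: oppr0.
  have neg w : (w *m c) 0 0 < 0 -> exists k, w 0 k < 0.
    move=> wc; apply: contrapT => /forallNP h.
    suff : 0 <= (w *m c) 0 0 by rewrite leNgt wc.
    rewrite mxE; apply: sumr_ge0 => k _; apply: mulr_ge0 => //.
    by rewrite leNgt; apply/negP/h.
  have [ucn|ucp|uc0] := ltgtP ((u *m c) 0 0) 0.
  - by exists u; split; [exact: ltW|exact: neg|].
  - have ucn : ((- u) *m c) 0 0 < 0 by rewrite mulNmx mxE oppr_lt0.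
    by exists (- u); split; [exact: ltW|exact: neg|].
  have [k uk] : exists k, u 0 k != 0.
    apply: contrapT => /forallNP h; move/eqP: u0; apply.
    by apply/rowP => k; rewrite mxE; apply/eqP/negPn/negP/h.
  have [ukn|ukp] := ltP (u 0 k) 0.
    by exists u; split=> //; [rewrite uc0|exists k].
  exists (- u); split=> //; first by rewrite mulNmx mxE uc0 oppr0.
  by exists k; rewrite mxE oppr_lt0 lt_def uk.
have ue0 : slope u (inl k) < 0 by [].
case: (arg_minP (P := fun e => slope u e < 0)
  (fun e => slack x e / - slope u e) ue0) => e ue emin.
set t := slack x e / - slope u e.
have Qxe := (polyhedronP x).1 Qx.
have t0 : 0 <= t by rewrite divr_ge0 // oppr_ge0 ltW.
exists (x + t *: u); split.
- apply/polyhedronP => i; rewrite slackD.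
  have [ui|ui] := ltP (slope u i) 0; last by rewrite addr_ge0 // mulr_ge0.
  by have := emin i ui; rewrite -/t ler_pdivlMr ?oppr_gt0 // mulrN; lra.
- by rewrite mulmxDl -scalemxAl !mxE gerDl mulr_ge0_le0 //; move: uc; rewrite mxE.
apply/properP; split.
  apply/fintype.subsetP => i; rewrite !inE slackD => /eqP xi.
  by rewrite xi ut // mulr0 addr0.
exists e; rewrite !inE.
  rewrite slackD /t invrN mulrN mulNr divfK ?subrr //.
  by rewrite lt_eqF.
by apply/eqP => /ut h; move: ue; rewrite h ltxx.
Qed.

Lemma vertex_below c x :
  (forall k, 0 <= c k 0) -> set_covering_polyhedron A x ->
  exists2 z, vertex (set_covering_polyhedron A) z
    & (z *m c) 0 0 <= (x *m c) 0 0.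
Proof.
move=> c0; move: {2}#|_| (leqnn #|~: tight x|) => N.
elim: N x => [|N IH] x xN Qx;
  (have [Vx|/(tighten_nonvertex c0 Qx)[y [Qy yx xy]]] :=
    pselect (vertex (set_covering_polyhedron A) x); first by exists x);
  have lt : (#|~: tight y| < #|~: tight x|)%N
    by rewrite proper_card // properC.
- by move: (leq_trans lt xN).
have [|z Vz zy] := IH y _ Qy; first by rewrite -ltnS (leq_trans lt).
by exists z => //; apply: le_trans yx.
Qed.

End Polyhedron.

(** * Powers of ideals and prime ideals *)

Section IdealPowers.
Variable S : comNzRingType.
Implicit Types (J p G : set S).

Lemma ideal_gen_ideal G : is_ideal (ideal_gen G).
Proof.
split=> [J []|a b Ga Gb J HJ|r a Ga J HJ]; first by case.
- by have [[_ addJ _] _] := HJ; apply: addJ; [exact: Ga|exact: Gb].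
- by have [[_ _ mulJ] _] := HJ; apply: mulJ; exact: Ga.
Qed.

Lemma ideal_pow_ideal J i : is_ideal (ideal_pow J i).
Proof. by case: i => [|i]; [split|exact: ideal_gen_ideal]. Qed.

Lemma ideal_pow_mul J i a b : J a -> ideal_pow J i b -> ideal_pow J i.+1 (a * b).
Proof. by move=> Ja Jb; apply: sub_gen_smallest; exists a, b. Qed.

Lemma ideal_sum J (T : Type) (r : seq T) (P : pred T) (F : T -> S) :
  is_ideal J -> (forall x, P x -> J (F x)) -> J (\sum_(x <- r | P x) F x).
Proof. by move=> [J0 JD _] JF; elim/big_ind: _. Qed.

Lemma prime_prod p (T : Type) (r : seq T) (F : T -> S) :
  is_prime p -> p (\prod_(x <- r) F x) -> exists x, p (F x).
Proof.
move=> [_ p1 pM]; elim: r => [|x r IH]; first by rewrite big_nil.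
by rewrite big_cons => /pM[px|/IH//]; exists x.
Qed.

Lemma prime_exp p x m : is_prime p -> p (x ^+ m) -> (0 < m)%N /\ p x.
Proof.
move=> pp; have [_ p1 pM] := pp; elim: m => [|m IH]; first by rewrite expr0.
by rewrite exprS => /pM[px|/IH[]].
Qed.

End IdealPowers.

(** * Monomial ideals *)

Section MonomialIdeals.
Variables (K : fieldType) (n : nat).
Implicit Types (U V W : set 'X_{1..n}) (J p : set {mpoly K[n]}).
Implicit Types (a b : 'X_{1..n}) (f : {mpoly K[n]}) (C : {set 'I_n}).

Definition supported U : set {mpoly K[n]} :=
  [set f | forall a, a \in msupp f -> U a].

Lemma supportedX U a : supported U 'X_[a] <-> U a.
Proof.
by split=> [|Ua b]; [apply|]; rewrite msuppX inE // => /eqP ->.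
Qed.

Lemma supportedM U V W : (forall a b, U a -> V b -> W (a + b)%MM) ->
  forall f h, supported U f -> supported V h -> supported W (f * h).
Proof.
move=> UVW f h Uf Vh a /msuppM_le /allpairsP[[b c] [/= /Uf Ub /Vh Vc ->]].
exact: UVW.
Qed.

Lemma supported_ideal U :
  (forall a b, U b -> U (a + b)%MM) -> is_ideal (supported U).
Proof.
move=> UD; split=> [a|f h Uf Uh a|f h Uh]; first by rewrite msupp0.
- by move=> /msuppD_le; rewrite mem_cat => /orP[/Uf|/Uh].
- by apply: (@supportedM setT U U) Uh => // a b _; apply: UD.
Qed.

Lemma supported_sub U J :
  is_ideal J -> (forall a, U a -> J 'X_[a]) -> supported U `<=` J.
Proof.
move=> JI UJ f Uf; rewrite [f]mpolyE big_seq_cond.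
apply: ideal_sum => // a; rewrite andbT => /Uf/UJ Ja.
by have [_ _ JM] := JI; rewrite -mul_mpolyC; exact: JM.
Qed.

(** An upper bound for the powers of [J], by a filtration [W] of the monomials
compatible with products. *)
Lemma ideal_pow_supported J (W : nat -> set 'X_{1..n}) :
  (forall i a b, W i b -> W i (a + b)%MM) -> (forall a, W 0%N a) ->
  (forall i a b, W 1%N a -> W i b -> W i.+1 (a + b)%MM) ->
  J `<=` supported (W 1%N) -> forall i, ideal_pow J i `<=` supported (W i).
Proof.
move=> Wup W0 WM JW; elim=> [f _ a _|i IH /=]; first exact: W0.
apply: smallest_sub => [|_ [f [h [/JW Wf /IH Wh ->]]]].
  by apply: supported_ideal => a b; apply: Wup.
by apply: supportedM Wf Wh => a b; apply: WM.
Qed.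

(** The order of the monomial [a] along the prime [(x_k : k \in C)]. *)
Definition cdeg C a := (\sum_(k in C) a k)%N.

Lemma cdegD C a b : cdeg C (a + b)%MM = (cdeg C a + cdeg C b)%N.
Proof. by rewrite -big_split; apply: eq_bigr => k _; rewrite mnmDE. Qed.

Lemma cdegU C k : cdeg C U_(k)%MM = (k \in C).
Proof.
rewrite /cdeg; have [kC|kC] := boolP (k \in C).
  rewrite (bigD1 k) //= mnm1E eqxx big1 // => j /andP[_ jk].
  by rewrite mnm1E eq_sym (negbTE jk).
rewrite big1 // => j jC; rewrite mnm1E; case: eqP => // kj.
by rewrite kj jC in kC.
Qed.

Lemma cdeg_gt0P C a : reflect (exists2 k, k \in C & (0 < a k)%N) (0 < cdeg C a)%N.
Proof.
rewrite lt0n sum_nat_eq0; apply: (iffP forallPn) => -[k].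
  by rewrite negb_imply -lt0n => /andP[]; exists k.
by move=> kC ak; exists k; rewrite negb_imply kC -lt0n.
Qed.

Lemma mnm_split a k : (0 < a k)%N -> exists b, a = (U_(k) + b)%MM.
Proof.
by move=> ak; exists (a - U_(k))%MM; rewrite addmC submK // lep1mP -lt0n.
Qed.

Lemma ideal_pow_monomial J C a i : is_ideal J ->
  (forall k, k \in C -> J 'X_k) -> (i <= cdeg C a)%N -> ideal_pow J i 'X_[a].
Proof.
move=> JI JC; elim: i a => [//|i IH] a ia.
have /cdeg_gt0P[k kC /mnm_split[b ab]] := leq_ltn_trans (leq0n i) ia.
rewrite ab mpolyXD; apply: ideal_pow_mul; first exact: JC.
by apply: IH; move: ia; rewrite ab cdegD cdegU kC.
Qed.

Lemma prime_monomial p a :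
  is_prime p -> p 'X_[a] -> exists2 k, (0 < a k)%N & p 'X_k.
Proof.
by move=> pp; rewrite mpolyXE_id => /(prime_prod pp)[k /(prime_exp pp)[]]; exists k.
Qed.

(** The prime ideal [(x_k : k \in C)]. *)
Definition var_ideal C := supported [set a | (0 < cdeg C a)%N].

(** Substituting [kill C] sets the variables of [C] to zero; the kernel of this
ring morphism into a domain is [var_ideal C], which is therefore prime. *)
Definition kill C : n.-tuple {mpoly K[n]} :=
  [tuple if k \in C then 0 else 'X_k | k < n].

Lemma kill_coeff C f a :
  (f \mPo kill C)@_a = (cdeg C a == 0)%N%:R * f@_a.
Proof.
have killX b : 'X_[b] \mPo kill C = (cdeg C b == 0)%N%:R *: 'X_[b].
  rewrite comp_mpolyX; case: posnP => [b0|/cdeg_gt0P[k kC bk]].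
    have E k : tnth (kill C) k ^+ b k = 'X_k ^+ b k.
      rewrite tnth_mktuple; case: ifP => // kC; move/eqP: b0.
      by rewrite sum_nat_eq0 => /forallP/(_ k); rewrite kC => /eqP ->.
    by rewrite scale1r mpolyXE_id (eq_bigr _ (fun k _ => E k)).
  by rewrite scale0r (bigD1 k) //= tnth_mktuple kC expr0n gtn_eqF // mul0r.
rewrite comp_mpolyEX [X in _ = _ * X@__]mpolyE !raddf_sum /= mulr_sumr.
apply: eq_bigr => b _; rewrite killX !mcoeffZ mcoeffX mulrCA.
by case: (b =P a) => [->//|_]; rewrite !mulr0.
Qed.

Lemma var_ideal_kernel C f : var_ideal C f <-> f \mPo kill C = 0.
Proof.
split=> [Cf|f0 a].
  apply/mpolyP => a; rewrite kill_coeff mcoeff0.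
  have [->|fa] := eqVneq f@_a 0; first by rewrite mulr0.
  by rewrite gtn_eqF ?mul0r // Cf // mcoeff_msupp.
rewrite mcoeff_msupp => fa; rewrite /= lt0n; apply/eqP => a0.
have := kill_coeff C f a; rewrite f0 a0 eqxx mul1r mcoeff0 => /esym/eqP.
by rewrite (negbTE fa).
Qed.

Lemma var_ideal_prime C : is_prime (var_ideal C).
Proof.
split=> [||f h].
- by apply: supported_ideal => a b /=; rewrite cdegD addn_gt0 orbC => ->.
- by move=> /var_ideal_kernel/eqP; rewrite comp_mpoly1 oner_eq0.
- move=> /var_ideal_kernel; rewrite rmorphM => /eqP; rewrite mulf_eq0.
  by case/orP => /eqP/var_ideal_kernel; [left|right].
Qed.

End MonomialIdeals.

Arguments supported K {n} U _.
Arguments var_ideal K {n} C _.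

(** * Ordinary and symbolic powers in terms of covers *)

Section EdgeIdeal.
Variables (K : fieldType) (n q : nat) (v : 'I_q -> 'X_{1..n}).
Implicit Types (a b : 'X_{1..n}) (f : {mpoly K[n]}) (C : {set 'I_n}).

Definition is_cover C := [forall j, (0 < cdeg C (v j))%N].

Definition msum (s : seq 'I_q) : 'X_{1..n} := (\big[+%MM/0%MM]_(j <- s) v j)%MM.

Definition packs i a := exists2 s, size s = i & (msum s <= a)%MM.

Definition edge_ideal := ideal_gen (range (fun j => 'X_[K, v j])).

Lemma packs_add i a b : packs i b -> packs i (a + b)%MM.
Proof. by case=> s si sb; exists s => //; apply: lepm_trans sb (lem_addl _ _). Qed.

Lemma packs_covered i a C : packs i a -> is_cover C -> (i <= cdeg C a)%N.
Proof.
move=> [s <- sa] /forallP vC; rewrite -(submK sa) cdegD.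
apply: leq_trans (leq_addl _ _).
elim: s {sa} => [//|j s IH]; rewrite /msum big_cons cdegD /= -add1n.
by rewrite leq_add.
Qed.

Lemma edge_ideal_sub J : is_ideal J ->
  (edge_ideal `<=` J <-> forall j, J 'X_[v j]).
Proof.
move=> JI; split=> [IJ j|Jv]; first by apply: IJ; apply: sub_gen_smallest; exists j.
by apply: smallest_sub => // _ [j _ <-].
Qed.

Lemma ideal_powP i : ideal_pow edge_ideal i = supported K (packs i).
Proof.
apply/seteqP; split.
  apply: ideal_pow_supported => [k a b|a|k a b|].
  - exact: packs_add.
  - by exists [::] => //; rewrite /msum big_nil; apply/mnm_lepP => k; rewrite mnm0E.
  - move=> [s sE /mnm_lepP sa] [s' sE' /mnm_lepP sb]; exists (s ++ s').
      by rewrite size_cat sE sE' add1n.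
    by rewrite /msum big_cat; apply/mnm_lepP => l; rewrite !mnmDE leq_add.
  - apply/edge_ideal_sub => [|j].
      by apply: supported_ideal => a b; exact: packs_add.
    by apply/supportedX; exists [:: j]; rewrite // /msum big_seq1 lepm_refl.
apply: supported_sub => [|a [s <- sa]]; first exact: ideal_pow_ideal.
have [_ _ mulI] := ideal_pow_ideal edge_ideal (size s).
rewrite -(submK sa) mpolyXD; apply: mulI; elim: s {sa} => [//|j s IH].
rewrite /msum big_cons mpolyXD; apply: ideal_pow_mul IH.
by apply: sub_gen_smallest; exists j.
Qed.

Lemma prime_cover p : is_prime p -> edge_ideal `<=` p ->
  is_cover [set k | `[< p 'X_k >]]%SET.
Proof.
move=> pp Ip; have pI : is_ideal p by case: pp.
apply/forallP => j; have [H _] := edge_ideal_sub pI.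
  have [k vk pk] := prime_monomial pp (H Ip j).
by apply/cdeg_gt0P; exists k => //; rewrite inE; apply/asboolP.
Qed.

(** A prime between the ideal and [var_ideal C] contains the variables of a
cover inside [C], hence all of [C] by minimality. *)
Lemma minimal_cover_prime C :
  minset is_cover C -> minimal_prime edge_ideal (var_ideal K C).
Proof.
move=> /minsetP[Cc Cmin]; have pC := var_ideal_prime K C.
split=> // [|p pp Ip pC'].
  have [CI _ _] := pC; apply/edge_ideal_sub => // j.
  by apply/supportedX; exact: (forallP Cc).
apply/seteqP; split=> //; have [pI _ _] := pp.
have pE : [set k | `[< p 'X_k >]]%SET = C.
  apply: Cmin; first exact: prime_cover.
  apply/fintype.subsetP => k; rewrite inE => /asboolP/pC'/supportedX /=.
  by rewrite cdegU lt0b.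
apply: supported_sub => // a /cdeg_gt0P[k + /mnm_split[b ->]].
rewrite -pE inE => /asboolP pk; have [_ _ pM] := pI.
by rewrite mpolyXD mulrC; apply: pM.
Qed.

(** One inclusion uses that minimal covers give minimal primes, the other that
every prime over the ideal contains the variables of some cover; a complete
list of the minimal primes is thus avoided. *)
Lemma symbolic_powP i :
  symbolic_pow edge_ideal i =
  supported K [set a | forall C, is_cover C -> (i <= cdeg C a)%N].
Proof.
apply/seteqP; split=> [f If a fa C Cc|].
  have [C' C'min C'C] := minset_exists Cc.
  have fC' := If _ (minimal_cover_prime C'min).
  have : supported K [set a | (i <= cdeg C' a)%N] f.
    pose W k := [set b : 'X_{1..n} | (k <= cdeg C' b)%N].
    apply: (ideal_pow_supported (W := W) _ _ _ _ fC') => // [k b c|k b c] /=.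
    - by rewrite /W /= cdegD => /leq_trans; apply; exact: leq_addl.
    - by rewrite /W /= cdegD -add1n; apply: leq_add.
  move=> /(_ a fa) /= /leq_trans; apply.
  by rewrite /cdeg (big_setID C' (A := C)) /= (finset.setIidPr C'C) leq_addr.
move=> f If p pmin; have [pp Ip _] := pmin; have [pI _ _] := pp.
apply: supported_sub f If => [|a Ia]; first exact: ideal_pow_ideal.
apply: ideal_pow_monomial (Ia _ (prime_cover pp Ip)) => // k.
by rewrite inE => /asboolP.
Qed.

Lemma ideal_pow_eq_symbolic i :
  ideal_pow edge_ideal i = symbolic_pow edge_ideal i <->
  forall a, (forall C, is_cover C -> (i <= cdeg C a)%N) -> packs i a.
Proof.
rewrite ideal_powP symbolic_powP; split=> [E a Ha|H].
  by apply/(@supportedX K); rewrite E; apply/supportedX.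
apply/seteqP; split=> f Hf a /Hf; last exact: H.
by move=> pa C; exact: packs_covered.
Qed.

End EdgeIdeal.

Arguments edge_ideal K {n q} v _.

(** * Monomials of the subring [K[Ft]] *)

Section MonomialAlgebras.
Variables (K : fieldType) (n q : nat) (v : 'I_q -> 'X_{1..n}).
Implicit Types (a b : 'X_{1..n}) (f h : {poly {mpoly K[n]}}).

Lemma monom_t_coeff a i k b :
  (b \in msupp (monom_t K a i)`_k) = (k == i) && (b == a).
Proof.
rewrite coefCM coefXn; case: eqP => _; last by rewrite mulr0 msupp0.
by rewrite mulr1 msuppX inE.
Qed.

Lemma monom_tD a b i j : monom_t K (a + b) (i + j) = monom_t K a i * monom_t K b j.
Proof. by rewrite /monom_t mpolyXD polyCM exprD mulrACA. Qed.

Lemma subalgebra_gen_subalgebra G : is_subalgebra (@subalgebra_gen K n G).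
Proof.
split=> [c B [[]]//|f h Gf Gh B HB|f h Gf Gh B HB].
- by have [[_ BD _] _] := HB; apply: BD; [exact: Gf|exact: Gh].
- by have [[_ _ BM] _] := HB; apply: BM; [exact: Gf|exact: Gh].
Qed.

Lemma monomial_subringP a i :
  monomial_subring K v (monom_t K a i) <-> exists2 s, size s = i & msum v s = a.
Proof.
have [_ _ KM] := subalgebra_gen_subalgebra (range (fun j => monom_t K (v j) 1)).
split=> [Ka|[s <- <-]]; last first.
  elim: s => [|j s IH].
    rewrite /msum big_nil /monom_t expr0 mulr1 mpolyX0.
    have [KC _ _] :=
      subalgebra_gen_subalgebra (range (fun j => monom_t K (v j) 1)).
    by rewrite -mpolyC1; exact: KC.
  rewrite /msum big_cons /= -add1n monom_tD; apply: KM IH.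
  by apply: sub_gen_smallest; exists j.
pose B := [set f : {poly {mpoly K[n]}} | forall k b, b \in msupp f`_k ->
  exists2 s, size s = k & msum v s = b].
suff : B (monom_t K a i) by apply; rewrite monom_t_coeff !eqxx.
apply: Ka; split; last first.
  move=> _ [j _ <-] k b; rewrite monom_t_coeff => /andP[/eqP -> /eqP ->].
  by exists [:: j]; rewrite // /msum big_seq1.
split=> [c k b|f h Bf Bh k b|f h Bf Bh k b].
- rewrite coefC; case: k => [|k]; rewrite ?msupp0 //= msuppC.
  case: eqP => // _; rewrite inE => /eqP ->.
  by exists [::]; rewrite // /msum big_nil.
- by rewrite coefD => /msuppD_le; rewrite mem_cat => /orP[/Bf|/Bh].
rewrite coefM => /msupp_sum_le /flatten_mapP[l _].
move=> /msuppM_le /allpairsP[[b1 b2] [/= /Bf[s sl <-] /Bh[s' sl' <-] ->]].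
exists (s ++ s'); last by rewrite /msum big_cat.
by rewrite size_cat sl sl' subnKC // -ltnS.
Qed.

End MonomialAlgebras.

(** * Exponent vectors as linear functionals *)

Section Combinatorics.
Variables (R : realType) (n q : nat) (v : 'I_q -> 'X_{1..n}).
Implicit Types (a b : 'X_{1..n}) (x z : 'rV[R]_n) (C : {set 'I_n}).

Let Q := set_covering_polyhedron (exp_matrix R v).
Let P := conv_hull (fun j => exp_vec R (v j)).

Definition dotm a x : R := \sum_k x 0 k * (a k)%:R.

Lemma dotmE a x : (x *m (exp_vec R a)^T) 0 0 = dotm a x.
Proof. by rewrite mxE; apply: eq_bigr => k _; rewrite !mxE. Qed.

Lemma exp_matrixE x j : (x *m exp_matrix R v) 0 j = dotm (v j) x.
Proof. by rewrite mxE; apply: eq_bigr => k _; rewrite !mxE. Qed.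

Lemma dotmD a b x : dotm (a + b) x = dotm a x + dotm b x.
Proof.
by rewrite -big_split; apply: eq_bigr => k _; rewrite /= mnmDE natrD mulrDr.
Qed.

Lemma dotm0 x : dotm 0 x = 0.
Proof. by apply: big1 => k _; rewrite mnm0E mulr0. Qed.

Definition indicator C : 'rV[R]_n := \row_k (k \in C)%:R.

Lemma dotm_indicator a C : dotm a (indicator C) = (cdeg C a)%:R.
Proof.
rewrite /cdeg natr_sum big_mkcond; apply: eq_bigr => k _.
by rewrite mxE; case: (k \in C); rewrite ?mul1r ?mul0r.
Qed.

Lemma cover_point C : is_cover v C -> Q (indicator C).
Proof.
move=> /forallP vC; split=> [k|j]; first by rewrite mxE ler0n.
by rewrite exp_matrixE dotm_indicator ler1n.
Qed.

Lemma packs_dotm i a x : packs v i a -> Q x -> i%:R <= dotm a x.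
Proof.
move=> [s <- sa] [x0 xv]; rewrite -(submK sa) dotmD.
have : 0 <= dotm (a - msum v s) x by apply: sumr_ge0 => k _; rewrite mulr_ge0.
suff : (size s)%:R <= dotm (msum v s) x by lra.
elim: s {sa} => [|j s IH]; first by rewrite /msum big_nil dotm0.
rewrite /msum big_cons dotmD /= -add1n natrD lerD //.
by rewrite -exp_matrixE.
Qed.

Lemma dilated_hullP i a :
  [set i%:R *: y | y in P] (exp_vec R a) ->
  exists l : 'I_q -> R, [/\ forall j, 0 <= l j, \sum_j l j = i%:R
    & forall k, (a k)%:R = \sum_j l j * (v j k)%:R].
Proof.
move=> [_ [l [l0 l1 ->]] lE]; exists (fun j => i%:R * l j); split=> [j||k].
- by rewrite mulr_ge0.
- by rewrite -mulr_sumr l1 mulr1.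
move/rowP/(_ k): lE; rewrite !mxE summxE mulr_sumr => <-.
by apply: eq_bigr => j _; rewrite !mxE mulrA.
Qed.

Lemma mem_dilated_hull i a (l : 'I_q -> R) : (0 < i)%N ->
  (forall j, 0 <= l j) -> \sum_j l j = i%:R ->
  (forall k, (a k)%:R = \sum_j l j * (v j k)%:R) ->
  [set i%:R *: y | y in P] (exp_vec R a).
Proof.
move=> i0 l0 l1 aE; have iN0 : i%:R != 0 :> R by rewrite pnatr_eq0 -lt0n.
exists (i%:R^-1 *: exp_vec R a); last by rewrite scalerA divff ?scale1r.
exists (fun j => i%:R^-1 * l j); split=> [j||].
- by rewrite mulr_ge0 ?invr_ge0.
- by rewrite -mulr_sumr l1 mulVf.
apply/rowP => k; rewrite !mxE summxE aE mulr_sumr.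
by apply: eq_bigr => j _; rewrite !mxE mulrA.
Qed.

Lemma hull_cdeg C (l : 'I_q -> R) (a : 'I_n -> R) :
  (forall k, a k = \sum_j l j * (v j k)%:R) ->
  \sum_(k in C) a k = \sum_j l j * (cdeg C (v j))%:R.
Proof.
move=> aE; rewrite (eq_bigr _ (fun k _ => aE k)) exchange_big.
by apply: eq_bigr => j _; rewrite /= natr_sum mulr_sumr.
Qed.

Definition hull_decomposes := forall i a,
  [set i%:R *: y | y in P] (exp_vec R a) ->
  exists2 s, size s = i & msum v s = a.

(** Both algebras are spanned by monomials, so it is enough to compare those;
[K[Ft]] is always contained in the Ehrhart ring, as [v j] lies in [P]. *)
Lemma monomial_subring_ehrhart (K : fieldType) :
  monomial_subring K v = ehrhart_ring K P <-> hull_decomposes.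
Proof.
split=> [E i a aP|nv].
  by apply/(monomial_subringP K); rewrite E; apply: sub_gen_smallest; exists a, i.
apply/seteqP; split; apply: smallest_sub => //;
  try exact: subalgebra_gen_subalgebra.
  move=> _ [j _ <-]; apply: sub_gen_smallest; exists (v j), 1%N; split=> //.
  apply: (@mem_dilated_hull _ _ (fun j' => (j' == j)%:R)) => //.
  - by rewrite (bigD1 j) //= eqxx big1 ?addr0 // => j' /negbTE ->.
  - move=> k; rewrite (bigD1 j) //= eqxx mul1r big1 ?addr0 // => j' /negbTE ->.
    by rewrite mul0r.
by move=> _ [a [i [/nv aP ->]]]; apply/monomial_subringP.
Qed.

(** * The min-max property *)

Definition min_max := forall i a, (0 < i)%N ->
  (forall C, is_cover v C -> (i <= cdeg C a)%N) -> packs v i a.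

(** The functional [a] below is the sum of the normals of the constraints tight
at [x]. As [cdeg C a] and [#|T|] are integers, either a cover attains [#|T|],
and its indicator is [x], or [a] packs [#|T|.+1], which exceeds its value at
[x]. *)
Lemma min_max_integral : min_max -> integral_polyhedron Q.
Proof.
move=> mm x Vx; have [Qx _] := Vx.
pose T := [set j | slack (exp_matrix R v) x (inr j) == 0]%SET.
pose Z := [set k | x 0 k == 0]%SET.
(* The summand with support [Z] is the sum of the unit vectors [U_(k)] for [k]
   in [Z]. *)
pose a : 'X_{1..n} := ((\big[+%MM/0%MM]_(j in T) v j) +
  [multinom nat_of_bool (k \in Z) | k < n])%MM.
have aE z : dotm a z = \sum_(j in T) dotm (v j) z + \sum_(k in Z) z 0 k.
  rewrite dotmD; congr (_ + _).
    by apply: (big_morph (dotm^~ z)) => [b c|]; rewrite ?dotm0 ?dotmD.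
  rewrite [RHS]big_mkcond; apply: eq_bigr => k _; rewrite mnmE.
  by case: (k \in Z); rewrite ?mulr1 ?mulr0.
have aE' z : dotm a z - #|T|%:R =
    \sum_(j in T) (dotm (v j) z - 1) + \sum_(k in Z) z 0 k.
  by rewrite aE sumrB sumr_const addrAC.
have ax : dotm a x = #|T|%:R.
  apply/eqP; rewrite -subr_eq0 aE' !big1 ?addr0 // => [k|j].
    by rewrite inE => /eqP.
  by rewrite inE /= exp_matrixE => /eqP.
have aQ z : Q z -> #|T|%:R <= dotm a z.
  move=> [z0 zv]; rewrite -subr_ge0 aE' addr_ge0 ?sumr_ge0 // => j _.
  by rewrite subr_ge0 -exp_matrixE.
have [[C Cc aC]|noC] := pselect (exists2 C, is_cover v C & cdeg C a = #|T|).
  have QC := cover_point Cc.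
  suff <- : indicator C = x by move=> k; rewrite mxE; case: (k \in C).
  apply: (vertex_tight_unique Vx QC).
  have [C0 Cv] := QC.
  move: (aE' (indicator C)); rewrite dotm_indicator aC subrr => /esym/eqP.
  have Cv' j : j \in T -> 0 <= dotm (v j) (indicator C) - 1.
    by move=> _; rewrite subr_ge0 -exp_matrixE.
  rewrite paddr_eq0 ?sumr_ge0 // !psumr_eq0 // => /andP[/allP CT /allP CZ].
  apply/fintype.subsetP => -[k|j]; rewrite !inE => xe.
    by apply: (implyP (CZ k (mem_index_enum k))); rewrite inE.
  rewrite /= exp_matrixE.
  by apply: (implyP (CT j (mem_index_enum j))); rewrite inE.
have : packs v #|T|.+1 a.
  apply: mm => // C Cc; rewrite ltn_neqAle; apply/andP; split.
    by apply/eqP => E; apply: noC; exists C.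
  by rewrite -(ler_nat R) -dotm_indicator; apply/aQ/cover_point.
by move=> /packs_dotm/(_ Qx); rewrite ax ler_nat ltnn.
Qed.

(** Membership in [iP] gives [i <= cdeg C a] for each cover and
[mdeg a = i * d]; since the generators have degree [d], a product of [i] of
them that divides [x^a] is equal to [x^a]. *)
Lemma min_max_hull_decomposes d : (forall j, mdeg (v j) = d) -> min_max -> hull_decomposes.
Proof.
move=> vd mm i a /dilated_hullP[l [l0 l1 aE]].
have adeg C : (cdeg C a)%:R = \sum_j l j * (cdeg C (v j))%:R.
  by rewrite natr_sum; apply: hull_cdeg.
have mdegT b : mdeg b = cdeg finset.setT b.
  by rewrite mdegE; apply: eq_bigl => k; rewrite inE.
have da : mdeg a = (i * d)%N.
  apply/eqP; rewrite -(eqr_nat R) mdegT adeg natrM -l1 mulr_suml.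
  by apply/eqP/eq_bigr => j _; rewrite -mdegT vd.
have [i0|i_gt0] := posnP i.
  exists [::] => //; rewrite /msum big_nil; apply/esym/eqP.
  by rewrite -mdeg_eq0 da i0.
have [|s si sa] := mm i a i_gt0.
  move=> C /forallP vC; rewrite -(ler_nat R) adeg -l1; apply: ler_sum => j _.
  by rewrite ler_peMr // ler1n.
exists s => //; rewrite -(submK sa) -[LHS]add0m; congr (_ + _)%MM.
apply/esym/eqP; rewrite -mdeg_eq0 -(eqn_add2r (mdeg (msum v s))) -mdegD submK //.
by rewrite da mdeg_sum (eq_bigr _ (fun j _ => vd j)) big_const_seq count_predT
  iter_addn_0 si mulnC.
Qed.

(** A vertex below [x] is integral, so it dominates the indicator of its
support, which is a cover. *)
Lemma integral_cover_bound i a x : integral_polyhedron Q ->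
  (forall C, is_cover v C -> (i <= cdeg C a)%N) -> Q x -> i%:R <= dotm a x.
Proof.
move=> intQ Ca Qx.
have [|z Vz] := @vertex_below _ _ _ _ (exp_vec R a)^T x _ Qx.
  by move=> k; rewrite !mxE ler0n.
rewrite !dotmE; apply: le_trans.
have [[z0 zv] _] := Vz.
pose C := [set k | z 0 k != 0]%SET.
have z1 k : (k \in C)%:R <= z 0 k.
  rewrite inE; case: eqP => [->//|/eqP zk].
  by rewrite -(ger0_norm (z0 k)); apply: norm_intr_ge1 => //; apply: intQ.
have Cz b : (cdeg C b)%:R <= dotm b z.
  rewrite -dotm_indicator; apply: ler_sum => k _.
  by rewrite mxE ler_wpM2r.
apply: le_trans (Cz a); rewrite ler_nat; apply: Ca.
apply/forallP => j; rewrite lt0n; apply/eqP => Cj.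
have : 0 < dotm (v j) z by rewrite -exp_matrixE (lt_le_trans _ (zv j)).
suff -> : dotm (v j) z = 0 by rewrite ltxx.
apply: big1 => k _; have [->|zk] := eqVneq (z 0 k) 0; first by rewrite mul0r.
move/eqP: Cj; rewrite sum_nat_eq0 => /forallP/(_ k); rewrite inE zk => /eqP ->.
by rewrite mulr0.
Qed.

(** Induction on the degree of [a]: as long as a variable can be removed from
[x^a] without violating a cover bound, remove it. Otherwise the fractional
packing given by duality exhausts [a], which is then a lattice point of [iP]. *)
Lemma integral_hull_decomposes_min_max :
  integral_polyhedron Q -> hull_decomposes -> min_max.
Proof.
move=> intQ nv i a i0; have [N] := ubnP (mdeg a).
elim: N a => // N IH a aN Ca.
have [[k ak Ck]|noK] := pselect (exists2 k, (0 < a k)%N &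
  forall C, is_cover v C -> (i <= cdeg C (a - U_(k))%MM)%N).
  have [b ab] := mnm_split ak; move: aN Ck; rewrite ab addmC addmK => bN Cb.
  rewrite addmC; apply: packs_add; apply: IH => //.
  by move: bN; rewrite mdegD mdeg1 addn1.
have [|k|x Qx|y [y0 y1 yA]] := @covering_duality _ _ _ (exp_matrix R v)
  (exp_vec R a)^T i%:R.
- exact: ler0n.
- by rewrite !mxE ler0n.
- by rewrite dotmE; exact: integral_cover_bound.
pose b k := \sum_j y j 0 * (v j k)%:R.
have ba k : b k <= (a k)%:R.
  have bE : (exp_matrix R v *m y) k 0 = b k.
    by rewrite mxE; apply: eq_bigr => j _; rewrite mxE mulrC.
  by have := yA k; rewrite bE !mxE.
have abE k : (a k)%:R = b k.
  have [ak|ak] := posnP (a k).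
    apply/eqP; rewrite eq_le ba andbT ak; apply: sumr_ge0 => j _.
    by rewrite mulr_ge0.
  have [C Cc Ck] : exists2 C, is_cover v C & (cdeg C (a - U_(k))%MM < i)%N.
    apply: contrapT => noC; apply: noK; exists k => // C Cc.
    by rewrite leqNgt; apply/negP => Ck; apply: noC; exists C.
  have [c ac] := mnm_split ak.
  have iC := Ca C Cc.
  have [kC Ci] : k \in C /\ cdeg C a = i.
    move: iC Ck; rewrite ac addmC addmK cdegD cdegU.
    case: (k \in C); rewrite ?addn0 ?addn1 => h1 h2; last by rewrite ltnNge h1 in h2.
    by split=> //; apply/eqP; rewrite eqn_leq h1 h2.
  (* The packing already uses [i] of the total [cdeg C a = i], so no coordinate in
     [C] has slack. *)
  have : \sum_(k' in C) ((a k')%:R - b k') <= 0.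
    rewrite sumrB -natr_sum -/(cdeg C a) Ci (hull_cdeg (a := b)
      (l := fun j => y j 0) C) // subr_le0 -y1; apply: ler_sum => j _.
    by rewrite ler_peMr // ler1n; exact: (forallP Cc).
  have nn j : j \in C -> 0 <= (a j)%:R - b j by move=> _; rewrite subr_ge0.
  rewrite le_eqVlt ltNge sumr_ge0 // orbF psumr_eq0 // => /allP.
  move=> /(_ k (mem_index_enum k)); rewrite kC subr_eq0 => /eqP; exact.
have [s si sa] := nv i a (mem_dilated_hull i0 y0 y1 abE).
by exists s; rewrite // sa lepm_refl.
Qed.

End Combinatorics.

Theorem proposition4p4 (K : fieldType) (R : realType) (n q g d : nat)
    (v : 'I_q -> 'X_{1..n}) (I : set {mpoly K[n]})
    (v_inj : injective v)
    (min_gen : minimally_generates (range (fun j => 'X_[K, v j])) I)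
    (square_free : forall j i, (v j i <= 1)%N)
    (covers : forall i, exists j, (0 < v j i)%N)
    (height_I : ideal_height I g) (g_ge2 : (2 <= g)%N)
    (same_degree : forall j, mdeg (v j) = d) (d_ge2 : (2 <= d)%N) :
  (forall i : nat, (1 <= i)%N -> ideal_pow I i = symbolic_pow I i) <->
  (integral_polyhedron (set_covering_polyhedron (exp_matrix R v)) /\
   monomial_subring K v = ehrhart_ring K (conv_hull (fun j => exp_vec R (v j)))).
Proof.
have [<- _] := min_gen; rewrite -/(edge_ideal K v).
have EhrE := monomial_subring_ehrhart R v K.
split=> [E|[intQ /EhrE hd] i i0].
  have mm : min_max v.
    by move=> i a i0; apply: (ideal_pow_eq_symbolic K v i).1; exact: E.
  split; first exact: min_max_integral.
  exact/EhrE/(min_max_hull_decomposes same_degree).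
apply/ideal_pow_eq_symbolic => a.
exact: (integral_hull_decomposes_min_max intQ hd).
Qed.
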